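(* The Weighted Efficient Domination problem can be solved robustly in time $O(n^5)$ on $\{2P_3,S_{1,2,2}\}$-free graphs, where $n$ is the number of vertices of the input graph.
   Context: All graphs are finite, undirected and simple. A vertex dominates itself and all its neighbors. A vertex set $D$ of $G$ is an efficient dominating set (e.d.) if every vertex of $G$ is dominated by exactly one vertex of $D$. Weighted Efficient Domination: given $G=(V,E)$ and $\omega:V\to\mathbb{N}$, find an e.d. of minimum total weight or determine that none exists. $2P_3$ is the disjoint union of two chordless paths on $3$ vertices. $S_{1,2,2}$ is the graph on vertices $a,b,c,d,e,f$ with edges $ab,bc,cd,de,cf$ only. A graph is $\{F_1,F_2\}$-free if it has no induced subgraph isomorphic to $F_1$ or $F_2$. An algorithm for a problem on a graph class $\mathcal{C}$ is robust if it accepts an arbitrary graph and either solves the problem correctly or correctly determines that the input is not in $\mathcal{C}$. *)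

(* Defs.v *)
From mathcomp Require Import all_boot.
Set Implicit Arguments. Unset Strict Implicit. Unset Printing Implicit Defensive.

Definition simple_graph (n : nat) (adj : rel 'I_n) : Prop :=
  (forall u v, adj u v = adj v u) /\ (forall u, adj u u = false).

Definition dominates n (adj : rel 'I_n) (u v : 'I_n) : bool := (u == v) || adj u v.

Definition efficient_dominating n (adj : rel 'I_n) (D : {set 'I_n}) : Prop :=
  forall v : 'I_n, #|[set u in D | dominates adj u v]| = 1.

Definition weight n (w : 'I_n -> nat) (D : {set 'I_n}) : nat := \sum_(v in D) w v.

Definition contains_induced n m (adj : rel 'I_n) (H : rel 'I_m) : Prop :=
  exists f : 'I_m -> 'I_n, injective f /\ forall a b, adj (f a) (f b) = H a b.

Definition edge_2P3 (a b : 'I_6) : bool :=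
  let e x y := [|| (x == 0) && (y == 1), (x == 1) && (y == 2),
                   (x == 3) && (y == 4) | (x == 4) && (y == 5)]%N in
  e (val a) (val b) || e (val b) (val a).

Definition edge_S122 (a b : 'I_6) : bool :=
  let e x y := [|| (x == 0) && (y == 1), (x == 1) && (y == 2),
                   (x == 2) && (y == 3), (x == 3) && (y == 4)
                 | (x == 2) && (y == 5)]%N in
  e (val a) (val b) || e (val b) (val a).

Definition twoP3_S122_free n (adj : rel 'I_n) : Prop :=
  ~ contains_induced adj edge_2P3 /\ ~ contains_induced adj edge_S122.

(* Machine model: a unit-cost RAM (registers and an unbounded memory of *)
(* natural numbers) with addition, truncated subtraction and           *)
(* comparisons, given as a small While-language with indirect memory   *)
(* access.  Each executed basic command / test costs one step.         *)
Inductive aexp : Type :=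
| AConst of nat
| AReg of nat
| ALoad of aexp
| AAdd of aexp & aexp
| ASub of aexp & aexp.

Inductive bexp : Type :=
| BLt of aexp & aexp
| BEq of aexp & aexp
| BNot of bexp
| BAnd of bexp & bexp.

Inductive com : Type :=
| CSkip
| CAssign of nat & aexp
| CStore of aexp & aexp
| CSeq of com & com
| CIf of bexp & com & com
| CWhile of bexp & com.

Record state := State { reg : nat -> nat; mem : nat -> nat }.

Fixpoint aeval (s : state) (e : aexp) : nat :=
  match e with
  | AConst k => k
  | AReg x => reg s x
  | ALoad e => mem s (aeval s e)
  | AAdd e1 e2 => aeval s e1 + aeval s e2
  | ASub e1 e2 => aeval s e1 - aeval s e2
  end.

Fixpoint beval (s : state) (b : bexp) : bool :=
  match b with
  | BLt e1 e2 => aeval s e1 < aeval s e2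
  | BEq e1 e2 => aeval s e1 == aeval s e2
  | BNot b => ~~ beval s b
  | BAnd b1 b2 => beval s b1 && beval s b2
  end.

Definition upd (f : nat -> nat) (x v : nat) : nat -> nat :=
  fun y => if y == x then v else f y.

Inductive exec : com -> state -> nat -> state -> Prop :=
| ExSkip s : exec CSkip s 1 s
| ExAssign s x e : exec (CAssign x e) s 1 (State (upd (reg s) x (aeval s e)) (mem s))
| ExStore s e1 e2 :
    exec (CStore e1 e2) s 1 (State (reg s) (upd (mem s) (aeval s e1) (aeval s e2)))
| ExSeq c1 c2 s s1 s2 k1 k2 :
    exec c1 s k1 s1 -> exec c2 s1 k2 s2 -> exec (CSeq c1 c2) s (k1 + k2) s2
| ExIfT b c1 c2 s s' k :
    beval s b -> exec c1 s k s' -> exec (CIf b c1 c2) s k.+1 s'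
| ExIfF b c1 c2 s s' k :
    ~~ beval s b -> exec c2 s k s' -> exec (CIf b c1 c2) s k.+1 s'
| ExWhileF b c s : ~~ beval s b -> exec (CWhile b c) s 1 s
| ExWhileT b c s s1 s2 k1 k2 :
    beval s b -> exec c s k1 s1 -> exec (CWhile b c) s1 k2 s2 ->
    exec (CWhile b c) s (k1 + k2).+1 s2.

(* Input encoding of (G, w) with n vertices:
     mem[0] = n,
     mem[1 + i*n + j] = 1 if ij is an edge, else 0   (i, j < n),
     mem[1 + n*n + i] = w(i)                          (i < n),
   all other memory cells and all registers are 0. *)
Definition adj_nat n (adj : rel 'I_n) (i j : nat) : bool :=
  match insub i, insub j with
  | Some a, Some b => adj a b
  | _, _ => false
  end.

Definition w_nat n (w : 'I_n -> nat) (i : nat) : nat :=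
  match insub i with Some a => w a | None => 0 end.

Definition init_state n (adj : rel 'I_n) (w : 'I_n -> nat) : state :=
  State (fun _ => 0)
        (fun a => if a == 0 then n
                  else if a <= n * n then
                    nat_of_bool (adj_nat adj ((a - 1) %/ n) ((a - 1) %% n))
                  else if a <= n * n + n then w_nat w (a - 1 - n * n)
                  else 0).

(* Output encoding: mem[0] is the status
     0 = "the input graph is not {2P3,S122}-free",
     1 = "the graph has no efficient dominating set",
     2 = "found"; then D = { i < n | mem[1 + i] <> 0 }. *)
Definition out_set n (s : state) : {set 'I_n} := [set v : 'I_n | mem s v.+1 != 0].

Definition robust_WED_output n (adj : rel 'I_n) (w : 'I_n -> nat) (s : state) : Prop :=
  [\/ mem s 0 = 0 /\ ~ twoP3_S122_free adj,
      mem s 0 = 1 /\ (forall D, ~ efficient_dominating adj D)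
    | mem s 0 = 2 /\ efficient_dominating adj (out_set n s) /\
      (forall D, efficient_dominating adj D -> weight w (out_set n s) <= weight w D)].

(* Main.v *)
(* Let D be an efficient dominating set of a {2P3, S122}-free graph.  If some v
   in D is not simplicial, then v is the middle of a P3, so the vertices at
   distance at least 3 from v, which include D \ {v}, induce a disjoint union of
   cliques; S122-freeness then forces each d in D \ {v} to satisfy N[t] <= N[d]
   for all its neighbours t in that region ("good").  If instead all of D is
   simplicial, D picks one vertex from each class of simplicial twins.  In both
   cases the qualified vertices split into twin classes, D is a transversal of
   them, and picking the lightest vertex of every class is optimal for v.  When
   this argument fails, the failure exhibits a forbidden induced subgraph, found
   by a first-order condition ([obstructed]).

   All conditions are first-order with at most five nested quantifiers over the
   vertices (four or three when evaluated inside loops over v, or over v and s),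
   so a compiler from formulas to nested loops yields the bound n^5. *)
From mathcomp Require Import all_boot zify.
Require Import Defs.
Set Implicit Arguments. Unset Strict Implicit. Unset Printing Implicit Defensive.

(** * Candidate sets *)

Section Graph.
Variables (n : nat) (adj : rel 'I_n) (w : 'I_n -> nat).
Local Notation dom := (dominates adj).

(** Distance at least 3, expressed as disjointness of closed neighbourhoods. *)
Definition far v s := ~~ [exists u, dom v u && dom s u].

Definition simplicial v :=
  ~~ [exists p, dom v p && [exists q, dom v q && ~~ dom p q]].

Definition good v s :=
  ~~ [exists t, dom s t && (far v t && [exists x, dom t x && ~~ dom s x])].

Definition qualified v s :=
  if simplicial v then simplicial s else (s == v) || (far v s && good v s).

(** Ties in weight are broken by the index, so that each twin class has exactly one first vertex. *)
Definition before t s := (w t < w s) || ((w t == w s) && (t < s)).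

Definition selected v s :=
  qualified v s &&
  ~~ [exists t, dom s t && (qualified v t && before t s)].

(** In terms of twin classes: the closed neighbourhoods of the classes of qualified vertices
    partition the vertex set. *)
Definition valid v :=
  ~~ [exists x, ~~ [exists s, qualified v s && dom s x]] &&
  ~~ [exists s, qualified v s &&
       [exists t, qualified v t &&
         (~~ dom s t && [exists x, dom s x && dom t x])]].

Definition far_P3 v :=
  [exists a, far v a && [exists b, (far v b && dom a b) &&
    [exists c, far v c && (dom b c && ~~ dom a c)]]].

(** An S122 centred at [z], at distance two from [v], without its leg towards [v]: the first [k']
    prolongs the leg through [k], the second is the pendant vertex. *)
Definition far_branching v :=
  [exists z, (~~ dom v z && ~~ far v z) &&
    [exists k, (dom z k && far v k) &&
      ([exists k', far v k' && (dom k k' && ~~ dom z k')] &&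
       [exists k', far v k' && (dom z k' && ~~ dom k k')])]].

Definition obstructed :=
  [exists v, ~~ simplicial v && (far_P3 v || far_branching v)].

(** * Forbidden subgraphs from obstructions *)

Hypothesis adjG : simple_graph adj.

Lemma dom_sym u v : dom u v = dom v u.
Proof. by rewrite /dominates eq_sym (proj1 adjG). Qed.

Lemma dom_refl v : dom v v.
Proof. by rewrite /dominates eqxx. Qed.

Lemma farP v s : reflect (forall u, dom v u -> dom s u -> False) (far v s).
Proof.
apply: (iffP existsPn) => [H u vu su|H u].
  by have := H u; rewrite vu su.
by apply/negP => /andP[vu su]; exact: H vu su.
Qed.

Lemma simplicialP v :
  reflect (forall p q, dom v p -> dom v q -> dom p q) (simplicial v).
Proof.
apply: (iffP existsPn) => [H p q vp vq|H p].
  have := H p; rewrite vp /= => /existsPn/(_ q).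
  by rewrite vq /= negbK.
apply/negP => /andP[vp /existsP[q /andP[vq]]].
by rewrite H.
Qed.

Lemma goodP v s :
  reflect (forall t x, dom s t -> far v t -> dom t x -> dom s x) (good v s).
Proof.
apply: (iffP existsPn) => [H t x st vt tx|H t].
  have := H t; rewrite st vt /= => /existsPn/(_ x).
  by rewrite tx /= negbK.
apply/negP => /and3P[st vt /existsP[x /andP[tx]]].
by rewrite (H t).
Qed.

Lemma adj_dom u v : u != v -> adj u v = dom u v.
Proof. by rewrite /dominates => /negbTE->. Qed.

(** Symmetry and irreflexivity leave only the fifteen pairs [a < b] to inspect. *)
Lemma induced6 (H : rel 'I_6) (f : 'I_6 -> 'I_n) :
  symmetric H -> irreflexive H ->
  (forall a b : 'I_6, a < b -> adj (f a) (f b) = H a b /\ f a != f b) ->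
  contains_induced adj H.
Proof.
move=> Hs Hi Hf; exists f; split => [a b fab|a b].
  apply/eqP/negPn/negP => nab; have [lab|lba|/val_inj eab] := ltngtP a b.
  - by have [_] := Hf a b lab; rewrite fab eqxx.
  - by have [_] := Hf b a lba; rewrite fab eqxx.
  - by rewrite eab eqxx in nab.
have [lab|lba|/val_inj ->] := ltngtP a b.
- by case: (Hf a b lab).
- by rewrite (proj1 adjG) Hs; case: (Hf b a lba).
- by rewrite Hi (proj2 adjG).
Qed.

Lemma ndom_adj u v : ~~ dom u v -> adj u v = false /\ u != v.
Proof. by rewrite /dominates negb_or => /andP[? /negbTE]. Qed.

Lemma dom_adj u v : dom u v -> u != v -> adj u v = true /\ u != v.
Proof. by move=> uv nuv; rewrite adj_dom. Qed.

(** A non-simplicial [v] has non-adjacent neighbours [p] and [q]. No far vertex is adjacent to the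
    closed neighbourhood of [v], so the path p - v - q and the far path induce a 2P3. *)
Lemma contains_far_P3 v : ~~ simplicial v -> far_P3 v ->
  contains_induced adj edge_2P3.
Proof.
move=> /negPn/existsP[p /andP[vp /existsP[q /andP[vq npq]]]].
move=> /existsP[a /andP[/farP va /existsP[b /andP[/andP[/farP vb ab]]]]].
move=> /existsP[c /andP[/farP vc /andP[bc nac]]].
have vv := dom_refl v.
have [pp qq] := (dom_refl p, dom_refl q).
have sep x y : dom v x -> (forall u, dom v u -> dom y u -> False) ->
    adj x y = false /\ x != y.
  by move=> vx vy; apply: ndom_adj; apply/negP; rewrite dom_sym; exact: vy.
have npv : p != v by apply: contraNneq npq => ->.
have nvq : v != q by rewrite eq_sym; apply: contraNneq npq => ->; rewrite dom_sym.
have nab : a != b by apply: contraNneq nac => ->.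
have nbc : b != c by apply: contraNneq nac => <-.
pose f (i : 'I_6) := nth v [:: p; v; q; a; b; c] i.
apply: (@induced6 _ f).
- by move=> x y; rewrite /edge_2P3 orbC.
- by case=> [[|[|[|[|[|[|?]]]]]] ?].
case=> [[|[|[|[|[|[|?]]]]]] ?] [[|[|[|[|[|[|?]]]]]] ?] //= _; rewrite /f /=.
all: try by apply: sep.
all: try by apply: ndom_adj.
all: try by apply: dom_adj => //; rewrite dom_sym.
all: by apply: dom_adj.
Qed.

(** Let [u] be a common neighbour of [v] and [z]. If [k1] and [k2] are adjacent, then k - k1 - k2 is
    a far P3; otherwise v - u - z - k - k1 with [k2] attached to [z] is an induced S122. *)
Lemma contains_far_branching v : ~~ simplicial v -> far_branching v ->
  contains_induced adj edge_2P3 \/ contains_induced adj edge_S122.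
Proof.
move=> nsv /existsP[z /andP[/andP[nvz]]].
move=> /negPn/existsP[u /andP[vu zu]] /existsP[k /andP[/andP[zk fk]]].
move=> /andP[/existsP[k1 /andP[fk1 /andP[kk1 nzk1]]]].
move=> /existsP[k2 /andP[fk2 /andP[zk2 nkk2]]].
have [k12|nk12] := boolP (dom k1 k2).
  left; apply: (contains_far_P3 nsv); apply/existsP; exists k; rewrite fk /=.
  apply/existsP; exists k1; rewrite fk1 kk1 /=.
  by apply/existsP; exists k2; rewrite fk2 k12 nkk2.
right; have vv := dom_refl v.
have sep x y : dom v x -> far v y -> adj x y = false /\ x != y.
  by move=> vx /farP vy; apply: ndom_adj; apply/negP; rewrite dom_sym; exact: vy.
have nvu : v != u by apply: contraNneq nvz => ->; rewrite dom_sym.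
have nuz : u != z by apply: contraNneq nvz => <-.
have farnz y : far v y -> z != y.
  by move=> /farP fy; apply/eqP => e; case: (fy u) => //; rewrite -e.
have nkk1 : k != k1 by apply: contraNneq nzk1 => <-.
pose f (i : 'I_6) := nth v [:: v; u; z; k; k1; k2] i.
apply: (@induced6 _ f).
- by move=> x y; rewrite /edge_S122 orbC.
- by case=> [[|[|[|[|[|[|?]]]]]] ?].
case=> [[|[|[|[|[|[|?]]]]]] ?] [[|[|[|[|[|[|?]]]]]] ?] //= _; rewrite /f /=.
all: try by apply: sep.
all: try by apply: ndom_adj.
all: try by apply: dom_adj => //; rewrite dom_sym.
all: by apply: dom_adj => //; apply: farnz.
Qed.

Lemma obstructed_not_free : obstructed -> ~ twoP3_S122_free adj.
Proof.
move=> /existsP[v /andP[nsv /orP[/(contains_far_P3 nsv)|]]]; first by move=> ? [].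
by move=> /(contains_far_branching nsv)[] ? [].
Qed.

(** * Twin classes and their lightest representatives *)

Lemma efficientP (D : {set 'I_n}) :
  efficient_dominating adj D <->
  (forall x, exists2 d, d \in D & dom d x) /\
  (forall x d e, d \in D -> e \in D -> dom d x -> dom e x -> d = e).
Proof.
split=> [HD|[Hex Hun] x].
  split=> [x|x d e dD eD dx ex].
    have /eqP/cards1P[d E] := HD x.
    have : d \in [set d] by rewrite inE.
    by rewrite -E inE => /andP[dD dx]; exists d.
  have /eqP/cards1P[c E] := HD x.
  have : d \in [set u in D | dom u x] by rewrite inE dD.
  have : e \in [set u in D | dom u x] by rewrite inE eD.
  by rewrite E !inE => /eqP-> /eqP->.
have [d dD dx] := Hex x; apply/eqP/cards1P; exists d.
apply/setP => e; rewrite !inE; apply/andP/eqP => [[eD ex]|->//].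
exact: Hun eD dD ex dx.
Qed.

(** A simplicial [s] has a clique as closed neighbourhood. In the other case [v] is dominated by no
    far vertex, and for two far vertices the goodness of [t], applied to its far neighbour [s],
    gives N[s] <= N[t]. *)
Lemma qualified_twins v s t x :
  qualified v s -> qualified v t -> dom s t -> dom s x -> dom t x.
Proof.
rewrite /qualified; case: ifP => _.
  by move=> /simplicialP Hs _ st sx; exact: Hs.
have far_v r : far v r -> dom v r = false.
  by move=> /farP vr; apply/negP => /vr; apply; exact: dom_refl.
move=> /orP[/eqP->|/andP[fs gs]] /orP[/eqP->|/andP[ft gt]] //.
- by rewrite far_v.
- by rewrite dom_sym far_v.
by move=> st sx; apply: (goodP _ _ gt s x) => //; rewrite dom_sym.
Qed.

Lemma before_total s t : before s t || before t s || (s == t).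
Proof.
by rewrite /before -val_eqE /=; case: (ltngtP (w s) (w t)) => //=; case: ltngtP.
Qed.

Lemma selected_min v s t :
  selected v s -> qualified v t -> dom s t -> ~~ before t s.
Proof.
move=> /andP[_ /existsPn/(_ t)] + qt st.
by rewrite st qt.
Qed.

Lemma selected_dom_eq v s t : selected v s -> selected v t -> dom s t -> s = t.
Proof.
move=> ss st dst; have [/andP[qs _] /andP[qt _]] := (ss, st).
have := selected_min ss qt dst.
have := selected_min st qs; rewrite dom_sym => /(_ dst).
by have := before_total s t => /orP[/orP[]->|/eqP].
Qed.

Lemma selected_exists v s :
  qualified v s -> exists2 r, selected v r & dom r s.
Proof.
move=> qs.
(* The minimum is taken in two stages, first the weight and then the index; the twin property makes
   it a minimum over the class of [r] as well. *)
pose P m := [exists t, [&& qualified v t, dom s t & m == w t]].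
have exP : exists m, P m.
  by exists (w s); apply/existsP; exists s; rewrite qs dom_refl eqxx.
case: (ex_minnP exP) => m /existsP[t0 /and3P[qt0 st0 /eqP mt0]] minm.
pose P' i := [exists t : 'I_n, [&& qualified v t, dom s t, w t == m & i == t :> nat]].
have exP' : exists i, P' i.
  by exists t0; apply/existsP; exists t0; rewrite qt0 st0 mt0 !eqxx.
case: (ex_minnP exP') => i /existsP[r /and4P[qr sr /eqP wr /eqP ir]] mini.
exists r; last by rewrite dom_sym.
rewrite /selected qr /=; apply/existsPn => t; apply/negP => /and3P[rt qt bt].
have st : dom s t by apply: (qualified_twins qr qs); rewrite // dom_sym.
have mt : m <= w t by apply: minm; apply/existsP; exists t; rewrite qt st eqxx.
move: bt; rewrite /before wr ltnNge mt /= => /andP[/eqP wt].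
rewrite ltnNge -ir mini //; apply/existsP; exists t.
by rewrite qt st wt !eqxx.
Qed.

Definition candidate v := [set s | selected v s].

(** A selected twin dominates whatever a qualified vertex dominates. Two selected vertices with a
    common dominated vertex are adjacent or equal by validity, hence equal by minimality. *)
Lemma valid_efficient v : valid v -> efficient_dominating adj (candidate v).
Proof.
move=> /andP[/existsPn cov /existsPn uniq]; apply/efficientP; split.
  move=> x; have /negPn/existsP[s /andP[qs sx]] := cov x.
  have [r sr rs] := selected_exists qs; exists r; first by rewrite inE.
  have /andP[qr _] := sr.
  by apply: (qualified_twins qs qr); rewrite // dom_sym.
move=> x s t; rewrite !inE => ss st sx tx.
apply: (selected_dom_eq ss st); have [/andP[qs _] /andP[qt _]] := (ss, st).
have := uniq s; rewrite qs /= => /existsPn/(_ t); rewrite qt /=.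
case: (dom s t) => //= /existsPn/(_ x).
by rewrite sx tx.
Qed.

(** * Optimality of the candidate of a member of an efficient dominating set *)

Section Optimality.
Variables (D : {set 'I_n}) (v : 'I_n).
Hypotheses (effD : efficient_dominating adj D) (vD : v \in D).
Hypothesis unobstructed : ~~ obstructed.
Hypothesis v_spec : simplicial v -> forall d, d \in D -> simplicial d.

(* If [d] is not good, witnessed by [t] and [x], then [x - t - d] is a far P3
   when [x] is far, and otherwise [x] is the centre of an S122 with legs
   [x - u - v], [x - t - d] and the edge from [x] to its dominator. *)
Lemma member_qualified d : d \in D -> qualified v d.
Proof.
move=> dD; rewrite /qualified; case: ifPn => [sv|nsv]; first exact: v_spec.
have [Dex Dun] := (efficientP D).1 effD.
have Dfar e : e \in D -> e != v -> far v e.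
  move=> eD nev; apply/farP => u vu eu.
  by case/eqP: nev; exact: Dun eD vD eu vu.
have [//|ndv] := eqVneq d v; have fd := Dfar _ dD ndv.
rewrite fd /=; apply/goodP => t x dt ft tx; apply/negPn/negP => ndx.
case/existsP: unobstructed; exists v; rewrite nsv /=; apply/orP.
have [fx|nfx] := boolP (far v x); [left|right].
  apply/existsP; exists d; rewrite fd /=; apply/existsP; exists t.
  by rewrite ft dt /=; apply/existsP; exists x; rewrite fx tx ndx.
have [e eD ex] := Dex x.
have nvx : ~~ dom v x.
  by apply/negP => vx; exact: (farP _ _ ft x vx tx).
have nev : e != v by apply: contraNneq nvx => <-.
have nte : ~~ dom t e.
  apply/negP; rewrite dom_sym => et; have E := Dun _ _ _ dD eD dt et.
  by rewrite E ex in ndx.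
apply/existsP; exists x; rewrite nvx nfx /=.
apply/existsP; exists t; rewrite (dom_sym x) tx ft /=; apply/andP; split.
  by apply/existsP; exists d; rewrite fd (dom_sym t) dt (dom_sym x) ndx.
by apply/existsP; exists e; rewrite Dfar // (dom_sym x) ex nte.
Qed.

(** If qualified [s] and [t] both dominate [x], their dominators in [D] are their twins and dominate
    [x] too, hence coincide; then [s] dominates [t]. *)
Lemma member_valid : valid v.
Proof.
have [Dex Dun] := (efficientP D).1 effD.
apply/andP; split; apply/existsPn.
  move=> x; have [d dD dx] := Dex x; apply/negPn/existsP; exists d.
  by rewrite member_qualified.
move=> s; apply/negP => /andP[qs /existsP[t /andP[qt /andP[nst]]]].
move=> /existsP[x /andP[sx tx]].
have [[d dD ds] [e eD et]] := (Dex s, Dex t).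
have [qd qe] := (member_qualified dD, member_qualified eD).
have dx : dom d x by apply: (qualified_twins qs qd); rewrite // dom_sym.
have ex : dom e x by apply: (qualified_twins qt qe); rewrite // dom_sym.
move: nst; rewrite (qualified_twins qd qs) //.
by rewrite (Dun _ _ _ dD eD dx ex).
Qed.

Lemma candidate_weight : weight w (candidate v) <= weight w D.
Proof.
have [Dex Dun] := (efficientP D).1 effD.
(* [f] sends a selected vertex to its dominator in [D], a qualified twin that cannot be lighter;
   injectivity of [f] bounds the sum by the weight of [D]. *)
pose f s := odflt s [pick d in D | dom d s].
have fP s : f s \in D /\ dom (f s) s.
  rewrite /f; case: pickP => [d /andP[//]|H].
  by have [d dD ds] := Dex s; have := H d; rewrite /= dD ds.
have finj : {in candidate v &, injective f}.
  move=> s t; rewrite !inE => ss st E; apply: (selected_dom_eq ss st).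
  have [[fsD fs] [_ ft]] := (fP s, fP t); have /andP[qs _] := ss.
  by apply: (qualified_twins (member_qualified fsD) qs); rewrite // E.
rewrite /weight (leq_trans (n := \sum_(s in candidate v) w (f s))) //.
  apply: leq_sum => s; rewrite inE => ss; have [fsD fs] := fP s.
  have := selected_min ss (member_qualified fsD); rewrite dom_sym fs.
  move=> /(_ isT); rewrite /before negb_or -leqNgt.
  by case/andP.
rewrite -(big_imset w finj) /=.
have sub : f @: candidate v \subset D by apply/subsetP => _ /imsetP[s _ ->]; case: (fP s).
by rewrite [leqRHS](big_setID (f @: candidate v)) /= (setIidPr sub) leq_addr.
Qed.
End Optimality.

Lemma candidate_optimal (D : {set 'I_n}) :
  0 < n -> ~~ obstructed -> efficient_dominating adj D ->
  exists2 v, valid v & weight w (candidate v) <= weight w D.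
Proof.
move=> n_gt0 nobs effD; have [Dex _] := (efficientP D).1 effD.
have [d dD _] := Dex (Ordinal n_gt0).
(* A non-simplicial member is preferred; the default [d] is reached only when all of [D] is
   simplicial. *)
pose v := odflt d [pick e in D | ~~ simplicial e].
have [vD vspec] : v \in D /\ (simplicial v -> forall e, e \in D -> simplicial e).
  rewrite /v; case: pickP => [e /andP[eD /negbTE->] //|H].
  by split=> // _ e eD; have := H e; rewrite /= eD /= => /negbFE.
by exists v; [exact: member_valid vD _ vspec|exact: candidate_weight vD _ vspec].
Qed.
End Graph.

(** * Bounded first-order formulas *)

Inductive fm : Type :=
| FConst of bool
| FDom of nat & nat
| FEq of nat & nat
| FBefore of nat & nat
| FIf of fm & fm & fm
| FEx of nat & fm.

Definition FNot a := FIf a (FConst false) (FConst true).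
Definition FAnd a b := FIf a b (FConst false).
Definition FOr a b := FIf a (FConst true) b.

(* The variables in scope at level [k] are [0, ..., k - 1]. *)
Fixpoint scoped (k : nat) (f : fm) : bool :=
  match f with
  | FConst _ => true
  | FDom x y | FEq x y | FBefore x y => (x < k) && (y < k)
  | FIf a b c => [&& scoped k a, scoped k b & scoped k c]
  | FEx x a => (x == k) && scoped k.+1 a
  end.

Fixpoint depth (f : fm) : nat :=
  match f with
  | FIf a b c => maxn (depth a) (maxn (depth b) (depth c))
  | FEx _ a => (depth a).+1
  | _ => 0
  end.

(** Not a plain syntactic size: the constants absorb the loop and test overhead in the bound
    [fsize f * n ^ depth f] on the running time. *)
Fixpoint fsize (f : fm) : nat :=
  match f with
  | FIf a b c => fsize a + fsize b + fsize c + 2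
  | FEx _ a => fsize a + 10
  | _ => 2
  end.

Definition update n (env : nat -> 'I_n) (x : nat) (i : 'I_n) : nat -> 'I_n :=
  fun y => if y == x then i else env y.

Fixpoint sem n (adj : rel 'I_n) (w : 'I_n -> nat) (f : fm) (env : nat -> 'I_n) : bool :=
  match f with
  | FConst b => b
  | FDom x y => dominates adj (env x) (env y)
  | FEq x y => env x == env y
  | FBefore x y => before w (env x) (env y)
  | FIf a b c => if sem adj w a env then sem adj w b env else sem adj w c env
  | FEx x a => [exists i, sem adj w a (update env x i)]
  end.

Definition Ffar k v s := FNot (FEx k (FAnd (FDom v k) (FDom s k))).
Definition Fsimplicial k v :=
  FNot (FEx k (FAnd (FDom v k) (FEx k.+1 (FAnd (FDom v k.+1) (FNot (FDom k k.+1)))))).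
Definition Fgood k v s :=
  FNot (FEx k (FAnd (FDom s k) (FAnd (Ffar k.+1 v k)
    (FEx k.+1 (FAnd (FDom k k.+1) (FNot (FDom s k.+1))))))).
Definition Fqualified k v s :=
  FIf (Fsimplicial k v) (Fsimplicial k s)
    (FOr (FEq s v) (FAnd (Ffar k v s) (Fgood k v s))).
Definition Fselected k v s :=
  FAnd (Fqualified k v s)
    (FNot (FEx k (FAnd (FDom s k) (FAnd (Fqualified k.+1 v k) (FBefore k s))))).
Definition Fvalid k v :=
  FAnd
    (FNot (FEx k (FNot (FEx k.+1 (FAnd (Fqualified k.+2 v k.+1) (FDom k.+1 k))))))
    (FNot (FEx k (FAnd (Fqualified k.+1 v k)
      (FEx k.+1 (FAnd (Fqualified k.+2 v k.+1) (FAnd (FNot (FDom k k.+1))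
        (FEx k.+2 (FAnd (FDom k k.+2) (FDom k.+1 k.+2))))))))).
Definition Ffar_P3 k v :=
  FEx k (FAnd (Ffar k.+1 v k) (FEx k.+1 (FAnd (FAnd (Ffar k.+2 v k.+1) (FDom k k.+1))
    (FEx k.+2 (FAnd (Ffar k.+3 v k.+2) (FAnd (FDom k.+1 k.+2) (FNot (FDom k k.+2)))))))).
Definition Ffar_branching k v :=
  FEx k (FAnd (FAnd (FNot (FDom v k)) (FNot (Ffar k.+1 v k)))
    (FEx k.+1 (FAnd (FAnd (FDom k k.+1) (Ffar k.+2 v k.+1))
      (FAnd
        (FEx k.+2 (FAnd (Ffar k.+3 v k.+2) (FAnd (FDom k.+1 k.+2) (FNot (FDom k k.+2)))))
        (FEx k.+2 (FAnd (Ffar k.+3 v k.+2) (FAnd (FDom k k.+2) (FNot (FDom k.+1 k.+2))))))))).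
Definition Fobstructed :=
  FEx 0 (FAnd (FNot (Fsimplicial 1 0)) (FOr (Ffar_P3 1 0) (Ffar_branching 1 0))).

(** The formulas copy the shape of the boolean predicates, so both sides are convertible. *)
Lemma sem_obstructed n (adj : rel 'I_n) w env :
  sem adj w Fobstructed env = obstructed adj.
Proof. by []. Qed.

Lemma sem_valid n (adj : rel 'I_n) w env :
  sem adj w (Fvalid 1 0) env = valid adj (env 0).
Proof. by []. Qed.

Lemma sem_selected n (adj : rel 'I_n) w env :
  sem adj w (Fselected 2 0 1) env = selected adj w (env 0) (env 1).
Proof. by []. Qed.

(** * Running time of While programs *)

(** Total correctness with a step bound. *)
Definition runs (c : com) (s : state) (T : nat) (P : state -> Prop) : Prop :=
  exists s' k, [/\ exec c s k s', k <= T & P s'].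

Lemma runs_weaken c s T T' (P P' : state -> Prop) :
  runs c s T P -> T <= T' -> (forall s', P s' -> P' s') -> runs c s T' P'.
Proof.
move=> [s' [k [ex kT Ps]]] TT PP; exists s', k.
by split=> //; [exact: leq_trans TT|exact: PP].
Qed.

Lemma runs_assign x e s (P : state -> Prop) :
  P (State (upd (reg s) x (aeval s e)) (mem s)) -> runs (CAssign x e) s 1 P.
Proof. by move=> Ps; exists (State (upd (reg s) x (aeval s e)) (mem s)), 1; split=> //; constructor. Qed.

Lemma runs_store e1 e2 s (P : state -> Prop) :
  P (State (reg s) (upd (mem s) (aeval s e1) (aeval s e2))) -> runs (CStore e1 e2) s 1 P.
Proof.
by move=> Ps; exists (State (reg s) (upd (mem s) (aeval s e1) (aeval s e2))), 1; split=> //; constructor.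
Qed.

Lemma runs_skip s (P : state -> Prop) : P s -> runs CSkip s 1 P.
Proof. by move=> Ps; exists s, 1; split=> //; constructor. Qed.

Lemma runs_seq c1 c2 s T1 T2 P Q :
  runs c1 s T1 Q -> (forall s1, Q s1 -> runs c2 s1 T2 P) ->
  runs (CSeq c1 c2) s (T1 + T2) P.
Proof.
move=> [s1 [k1 [ex1 le1 Qs]]] H; have [s2 [k2 [ex2 le2 Ps]]] := H s1 Qs.
by exists s2, (k1 + k2); split=> //; [exact: ExSeq ex1 ex2|exact: leq_add].
Qed.

Lemma runs_if b c1 c2 s T P :
  (beval s b -> runs c1 s T P) -> (~~ beval s b -> runs c2 s T P) ->
  runs (CIf b c1 c2) s T.+1 P.
Proof.
move=> H1 H2; have [bb|bb] := boolP (beval s b).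
  by have [s' [k [ex le Ps]]] := H1 bb; exists s', k.+1; split=> //; exact: ExIfT.
by have [s' [k [ex le Ps]]] := H2 bb; exists s', k.+1; split=> //; exact: ExIfF.
Qed.

(** The invariant is indexed by the number of completed rounds; each round pays for its test, and
    the final [1] for the failing test. *)
Lemma runs_while b c (I : nat -> state -> Prop) n T :
  (forall i s, i < n -> I i s -> beval s b /\ runs c s T (I i.+1)) ->
  (forall s, I n s -> ~~ beval s b) ->
  forall s, I 0 s -> runs (CWhile b c) s (n * T.+1 + 1) (I n).
Proof.
move=> step stop.
suff main m i s : i + m = n -> I i s -> runs (CWhile b c) s (m * T.+1 + 1) (I n).
  by move=> s; exact: main.
elim: m i s => [|m IH] i s.
  rewrite addn0 => -> Is; exists s, 1; split=> //.
  by apply: ExWhileF; exact: stop.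
move=> imn Is; have [//|bs [s1 [k1 [ex1 le1 I1]]]] := step i s _ Is; first by lia.
have [//|s2 [k2 [ex2 le2 I2]]] := IH i.+1 s1 _ I1; first by lia.
by exists s2, (k1 + k2).+1; split=> //; [exact: ExWhileT ex1 ex2|lia].
Qed.

(** * Compilation *)

(* Register 0 receives truth values, 1 holds [n], 2 holds [n * n]; the variable
   [x] lives in [var x], and [row x] holds [x * n], the language having no
   multiplication. *)
Definition var x := x.*2 + 10.
Definition row x := x.*2 + 11.

Definition for_loop x (c : com) : com :=
  CSeq (CAssign (var x) (AConst 0)) (CSeq (CAssign (row x) (AConst 0))
    (CWhile (BLt (AReg (var x)) (AReg 1))
      (CSeq c (CSeq (CAssign (var x) (AAdd (AReg (var x)) (AConst 1)))
                    (CAssign (row x) (AAdd (AReg (row x)) (AReg 1))))))).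

Definition Bdom x y :=
  BNot (BAnd (BNot (BEq (AReg (var x)) (AReg (var y))))
    (BEq (ALoad (AAdd (AConst 1) (AAdd (AReg (row x)) (AReg (var y))))) (AConst 0))).
Definition Bor a b := BNot (BAnd (BNot a) (BNot b)).
Definition Aweight x := ALoad (AAdd (AConst 1) (AAdd (AReg 2) (AReg (var x)))).
Definition Bbefore x y :=
  Bor (BLt (Aweight x) (Aweight y))
      (BAnd (BEq (Aweight x) (Aweight y)) (BLt (AReg (var x)) (AReg (var y)))).
Definition test b := CIf b (CAssign 0 (AConst 1)) (CAssign 0 (AConst 0)).
Definition on_true c1 c2 := CIf (BEq (AReg 0) (AConst 1)) c1 c2.

(** A quantifier becomes a full loop: once register 0 holds 1, the remaining rounds skip the
    body. *)
Fixpoint compile (f : fm) : com :=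
  match f with
  | FConst b => CAssign 0 (AConst b)
  | FDom x y => test (Bdom x y)
  | FEq x y => test (BEq (AReg (var x)) (AReg (var y)))
  | FBefore x y => test (Bbefore x y)
  | FIf a b c => CSeq (compile a) (on_true (compile b) (compile c))
  | FEx x a =>
      CSeq (CAssign 0 (AConst 0)) (for_loop x (on_true CSkip (compile a)))
  end.

(** Registers from [var k] on are scratch space for loops at level [k] and deeper. *)
Definition frame (xs : seq nat) k (s s' : state) :=
  mem s' = mem s /\ forall r, r \notin xs -> r < var k -> reg s' r = reg s r.

Lemma frame_trans xs k s1 s2 s3 : frame xs k s1 s2 -> frame xs k s2 s3 -> frame xs k s1 s3.
Proof.
move=> [m1 r1] [m2 r2]; split; first by rewrite m2.
by move=> r rx rk; rewrite r2 // r1.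
Qed.

Lemma frame_sub xs ys j k s s' :
  {subset xs <= ys} -> j <= k -> frame xs k s s' -> frame ys j s s'.
Proof.
move=> xy jk [m r]; split=> // x xys xj; apply: r; last by rewrite /var in xj *; lia.
by apply: contra xys; exact: xy.
Qed.

Lemma frame_assign xs k s x v : x \in xs -> frame xs k s (State (upd (reg s) x v) (mem s)).
Proof.
move=> xx; split=> //= r rx _; rewrite /upd; case: eqP => // rE.
by rewrite rE xx in rx.
Qed.

(** The invariant must survive changes from [var k] on, because the loop itself updates its counter
    [var k] and the multiple [row k]. *)
Lemma runs_for k c T n (I : nat -> state -> Prop) s :
  (forall i s s', I i s -> frame [::] k s s' -> I i s') ->
  (forall i s, I i s -> reg s 1 = n) ->
  (forall i s, i < n -> I i s -> reg s (var k) = i -> reg s (row k) = i * n ->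
     runs c s T (fun s' => [/\ I i.+1 s', reg s' (var k) = i & reg s' (row k) = i * n])) ->
  I 0 s -> runs (for_loop k c) s (n * (T + 3) + 3) (I n).
Proof.
move=> Isame In step I0.
have row_var : (row k == var k) = false by rewrite /row /var; lia.
have var_row : (var k == row k) = false by rewrite /row /var; lia.
have one_var : (1 == var k) = false by rewrite /var; lia.
have low r : r < var k -> (r == var k = false) * (r == row k = false).
  by rewrite /row /var => H; split; lia.
(* Two initialisations and the failing test cost 3; each round adds a test and two increments to the
   body. *)
rewrite [_ + 3](_ : _ = 1 + (1 + (n * (T + (1 + 1)).+1 + 1))); last by lia.
apply: (runs_seq (runs_assign (P := eq _) erefl)) => _ <-.
apply: (runs_seq (runs_assign (P := eq _) erefl)) => _ <- /=.
pose J i s := [/\ I i s, reg s (var k) = i & reg s (row k) = i * n].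
apply: (@runs_weaken _ _ (n * (T + (1 + 1)).+1 + 1) _ (J n)) => //; last by move=> ? [].
apply: runs_while.
- move=> i s1 lt_in [I1 v1 r1]; split; first by rewrite /= v1 (In _ _ I1).
  apply: (runs_seq (step i s1 lt_in I1 v1 r1)) => s2 [I2 v2 r2].
  apply: (runs_seq (runs_assign (P := eq _) erefl)) => _ <-.
  apply: runs_assign; rewrite /J /= /upd !eqxx var_row row_var one_var v2 r2 (In _ _ I2) /=.
  split; [|by rewrite addn1|by rewrite mulSn addnC].
  apply: Isame I2 _; split=> //= r _ /low[h1 h2].
  by rewrite h1 h2.
- by move=> s1 [I1 v1 _]; rewrite /= v1 (In _ _ I1) ltnn.
split; rewrite /= /upd ?eqxx ?var_row ?row_var //.
by apply: Isame I0 _; split=> //= r _ /low[h1 h2]; rewrite h1 h2.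
Qed.

(** * Cost and correctness of compiled formulas *)

Fixpoint cost n (f : fm) : nat :=
  match f with
  | FIf a b c => cost n a + (cost n b + cost n c).+1
  | FEx _ a => 1 + (n * ((cost n a).+2 + 3) + 3)
  | _ => 2
  end.

Lemma cost_le n f d : 0 < n -> depth f <= d -> cost n f <= fsize f * n ^ d.
Proof.
move=> n_gt0; have pos m : 0 < n ^ m by rewrite expn_gt0 n_gt0.
elim: f d => [b|x y|x y|x y|a IHa b IHb c IHc|x a IHa] d /=; try by have := pos d; nia.
  rewrite !geq_max => /and3P[/IHa ha /IHb hb /IHc hc]; have := pos d; nia.
case: d => // d; rewrite ltnS => /IHa ha; rewrite expnS.
set p := n ^ d in ha *; have := pos d; rewrite -/p => hp.
(* These products of variables are supplied by hand for the nonlinear arithmetic that follows. *)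
have : n * cost n a <= n * (fsize a * p) by rewrite leq_mul2l ha orbT.
have : n <= n * p by rewrite leq_pmulr.
have : n * (fsize a * p) = fsize a * (n * p) by rewrite mulnCA.
have : 0 < n * p by rewrite muln_gt0 n_gt0.
nia.
Qed.

Section Compile.
Variables (n : nat) (adj : rel 'I_n) (w : 'I_n -> nat).

Definition represents (m : nat -> nat) :=
  (forall i j : 'I_n, m (1 + (i * n + j)) = adj i j) /\
  (forall i : 'I_n, m (1 + (n * n + i)) = w i).

Definition holds_env k (env : nat -> 'I_n) (s : state) :=
  [/\ reg s 1 = n, reg s 2 = n * n, represents (mem s) &
      forall x, x < k -> reg s (var x) = env x /\ reg s (row x) = env x * n].

(** Registers 0 and 3 to 9 may change freely: they hold neither [n], [n * n] nor a variable. *)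
Lemma holds_env_frame xs k j env s s' : j <= k ->
  all (fun r => (r == 0) || (2 < r < 10)) xs ->
  frame xs k s s' -> holds_env j env s -> holds_env j env s'.
Proof.
move=> jk /allP xs10 [m r] [n1 n2 rep e].
have nx x : (0 < x < 3) || (10 <= x) -> x \notin xs.
  by move=> hx; apply/negP => /xs10; lia.
split; rewrite ?m ?r ?nx // /var; [by lia|by lia|] => x xj.
have [<- <-] := e x xj.
by rewrite !r ?nx // /var /row; lia.
Qed.

Lemma runs_test k env s b v :
  holds_env k env s -> beval s b = v ->
  runs (test b) s 2 (fun s' => frame [:: 0] k s s' /\ reg s' 0 = v).
Proof.
move=> E bv; apply: runs_if => hb; apply: runs_assign; split=> //=.
- exact: frame_assign (mem_head _ _).
- by rewrite -bv hb.
- exact: frame_assign (mem_head _ _).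
- by rewrite -bv (negbTE hb).
Qed.

Lemma compile_correct f k env s :
  scoped k f -> holds_env k env s ->
  runs (compile f) s (cost n f)
    (fun s' => frame [:: 0] k s s' /\ reg s' 0 = sem adj w f env).
Proof.
elim: f k env s => [b|x y|x y|x y|a IHa b IHb c IHc|x a IHa] k env s /=.
- move=> _ E; apply: runs_weaken (runs_assign (P := eq _) erefl) _ _ => // _ <-.
  by split=> //; exact: frame_assign (mem_head _ _).
- move=> /andP[xk yk] E; apply: (runs_test E).
  have [_ _ [madj _] e] := E; have [[vx rx] [vy _]] := (e x xk, e y yk).
  rewrite /= vx vy rx madj /dominates negb_and negbK.
  by case: (adj _ _); rewrite ?orbT ?orbF.
- move=> /andP[xk yk] E; apply: (runs_test E).
  by have [_ _ _ e] := E; rewrite /= (e x xk).1 (e y yk).1.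
- move=> /andP[xk yk] E; apply: (runs_test E).
  have [_ n2 [_ mw] e] := E; rewrite /= n2 (e x xk).1 (e y yk).1 !mw.
  by rewrite /before negb_and !negbK.
- move=> /and3P[sa sb sc] E; apply: (runs_seq (IHa _ _ _ sa E)) => s1 [S1 R1].
  have E1 := holds_env_frame (xs := [:: 0]) (leqnn k) isT S1 E.
  have trans s' v : frame [:: 0] k s1 s' /\ reg s' 0 = v ->
      frame [:: 0] k s s' /\ reg s' 0 = v.
    by move=> [S2 ->]; split=> //; exact: frame_trans S1 S2.
  apply: runs_if; rewrite /= R1; case: (sem adj w a env) => //= _.
    by apply: (runs_weaken (IHb _ _ _ sb E1)) => [|s']; [lia|exact: trans].
  by apply: (runs_weaken (IHc _ _ _ sc E1)) => [|s']; [lia|exact: trans].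
move=> /andP[/eqP-> sa] E.
apply: (runs_seq (runs_assign (P := eq _) erefl)) => _ <- /=.
(* Register 0 records whether a witness has occurred among the first [i] vertices. *)
pose I i s' := frame [:: 0] k s s' /\
  reg s' 0 = [exists j : 'I_n, (j < i) && sem adj w a (update env k j)].
apply: (@runs_weaken _ _ (n * ((cost n a).+2 + 3) + 3) _ (I n)) => //; last first.
  move=> s' [S ->]; split=> //; congr nat_of_bool.
  by apply: eq_existsb => j; rewrite ltn_ord.
apply: runs_for.
- move=> i s1 s2 [S1 R1] S2; split.
    by apply: frame_trans S1 (frame_sub _ (leqnn k) S2).
  by rewrite S2.2 // /var; lia.
- move=> i s1 [[_ S1] _]; have [n1 _ _ _] := E; rewrite S1 //.
  by rewrite /var; lia.
- move=> i s1 lt_in [S1 R1] vi ri.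
  apply: runs_if; rewrite /= R1; set ex := [exists j, _]; case Dex : ex => //= _.
    apply: (runs_weaken (runs_skip (P := eq s1) erefl)) => // s' <-.
    split=> //; split=> //; rewrite R1 -/ex Dex.
    suff -> : [exists j : 'I_n, (j < i.+1) && sem adj w a (update env k j)] by [].
    have /existsP[j /andP[ji sj]] := Dex.
    by apply/existsP; exists j; rewrite sj ltnS ltnW.
  pose oi := Ordinal lt_in.
  have E1 : holds_env k.+1 (update env k oi) s1.
    have [n1 n2 rep e] := holds_env_frame (xs := [:: 0]) (leqnn k) isT S1 E; split=> // y.
    rewrite ltnS leq_eqVlt => /orP[/eqP->|yk]; first by rewrite /update eqxx.
    by rewrite /update (ltn_eqF yk); exact: e.
  apply: (runs_weaken (IHa _ _ _ sa E1)) => [|s' [[m' r'] R']]; first by lia.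
  split; try by rewrite r' // ?inE /var /row; lia.
  split.
    apply: frame_trans S1 _; split=> // r r0 rk.
    by rewrite r' //; move: rk; rewrite /var; lia.
  rewrite R'; congr nat_of_bool; apply/idP/existsP => [sa1|[j /andP[]]].
    by exists oi; rewrite sa1 /= ltnSn.
  rewrite ltnS leq_eqVlt => /orP[/eqP ji|ji] sj.
    by rewrite (_ : oi = j) //; exact: val_inj.
  by move/existsPn/(_ j): (negbT Dex); rewrite ji sj.
split=> /=.
  exact: frame_assign (mem_head _ _).
by rewrite /upd /=; case: existsP => // -[j].
Qed.
End Compile.

(** * The algorithm *)

Definition Fsel := Fselected 2 0 1.

(* Register 7 accumulates the weight of the candidate of variable 0. *)
Definition sum_prog :=
  CSeq (CAssign 7 (AConst 0))
    (for_loop 1 (CSeq (compile Fsel)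
      (on_true (CAssign 7 (AAdd (AReg 7) (Aweight 1))) CSkip))).

(* Registers 3 to 6: whether some valid vertex has been met, the least weight
   so far, and the vertex attaining it together with its multiple by [n]. *)
Definition search_body :=
  CSeq (compile (Fvalid 1 0))
    (on_true
      (CSeq sum_prog
        (CIf (BAnd (BEq (AReg 3) (AConst 1)) (BNot (BLt (AReg 7) (AReg 4)))) CSkip
          (CSeq (CAssign 3 (AConst 1)) (CSeq (CAssign 4 (AReg 7))
            (CSeq (CAssign 5 (AReg (var 0))) (CAssign 6 (AReg (row 0))))))))
      CSkip).

Definition search_prog := CSeq (CAssign 3 (AConst 0)) (for_loop 0 search_body).

Definition Amark := AAdd (AConst 1) (AAdd (AReg 2) (AAdd (AReg 1) (AReg (var 1)))).

(* The output cells overlap the adjacency matrix, so the candidate is first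
   written behind the input. *)
Definition mark_prog := for_loop 1 (CSeq (compile Fsel) (CStore Amark (AReg 0))).
Definition copy_prog :=
  for_loop 1 (CStore (AAdd (AConst 1) (AReg (var 1))) (ALoad Amark)).
Definition output_prog :=
  CSeq (CAssign (var 0) (AReg 5)) (CSeq (CAssign (row 0) (AReg 6))
    (CSeq mark_prog (CSeq copy_prog (CStore (AConst 0) (AConst 2))))).

Definition square_prog := for_loop 0 (CAssign 2 (AAdd (AReg 2) (AReg 1))).

(** The case of no vertices is separate, since every candidate is generated by a vertex. *)
Definition wed_prog :=
  CSeq (CAssign 1 (ALoad (AConst 0)))
    (CIf (BEq (AReg 1) (AConst 0)) (CStore (AConst 0) (AConst 2))
      (CSeq square_prog (CSeq (compile Fobstructed)
        (on_true (CStore (AConst 0) (AConst 0))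
          (CSeq search_prog
            (CIf (BEq (AReg 3) (AConst 0)) (CStore (AConst 0) (AConst 1))
              output_prog)))))).

(** * Correctness of the programs *)

Section Algorithm.
Variables (n : nat) (adj : rel 'I_n) (w : 'I_n -> nat).
Local Notation holds_env := (holds_env adj w).
Local Notation represents := (represents adj w).

Lemma holds_env_var k env (i : 'I_n) s :
  holds_env k env s -> reg s (var k) = i -> reg s (row k) = i * n ->
  holds_env k.+1 (update env k i) s.
Proof.
move=> [n1 n2 rep e] vi ri; split=> // x.
rewrite ltnS leq_eqVlt /update => /orP[/eqP->|xk]; first by rewrite eqxx.
by rewrite (ltn_eqF xk); exact: e.
Qed.

Definition sum_cost := 1 + (n * ((cost n Fsel + 2) + 3) + 3).

Lemma runs_sum env s : holds_env 1 env s ->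
  runs sum_prog s sum_cost (fun s' =>
    frame [:: 0; 7] 1 s s' /\ reg s' 7 = weight w (candidate adj w (env 0))).
Proof.
move=> E; apply: (runs_seq (runs_assign (P := eq _) erefl)) => _ <- /=.
pose I i s' := frame [:: 0; 7] 1 s s' /\
  reg s' 7 = \sum_(j : 'I_n | (j < i) && selected adj w (env 0) j) w j.
apply: (@runs_weaken _ _ (n * ((cost n Fsel + 2) + 3) + 3) _ (I n)) => //; last first.
  move=> s' [S ->]; split=> //; apply: eq_bigl => j.
  by rewrite ltn_ord inE.
have hold s1 : frame [:: 0; 7] 1 s s1 -> holds_env 1 env s1.
  by move=> S1; apply: (holds_env_frame (xs := [:: 0; 7])) S1 E.
apply: runs_for.
- move=> i s1 s2 [S1 R1] S2; split; last by rewrite S2.2.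
  by apply: frame_trans S1 (frame_sub _ (leqnn 1) S2).
- by move=> i s1 [/hold[]].
- move=> i s1 lt_in [S1 R1] vi ri.
  pose oi := Ordinal lt_in.
  have E1 : holds_env 2 (update env 1 oi) s1 by apply: holds_env_var (hold _ S1) _ _.
  (* The term of index [i] is split off the partial sum. *)
  have split_sum : \sum_(j : 'I_n | (j < i.+1) && selected adj w (env 0) j) w j =
      \sum_(j : 'I_n | (j < i) && selected adj w (env 0) j) w j
      + (if selected adj w (env 0) oi then w oi else 0).
    rewrite (bigID (pred1 oi)) /= addnC; congr (_ + _).
      apply: eq_bigl => j; rewrite -val_eqE /= ltnS leq_eqVlt.
      by case: (ltngtP j i); rewrite ?andbT ?andbF.
    case sel: (selected _ _ _ oi); [apply: big_pred1|apply: big_pred0] => j /=;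
      by have [->|] := eqVneq j oi; rewrite ?andbF // sel ltnSn.
  apply: (runs_seq (@compile_correct _ adj w Fsel 2 _ _ isT E1)) => s2 [S2 R2].
  have E2 := holds_env_frame (xs := [:: 0]) (leqnn 2) isT S2 E1.
  have S02 : frame [:: 0; 7] 1 s s2.
    by apply: frame_trans S1 (frame_sub _ _ S2) => // x; rewrite !inE => ->.
  have [v2 r2] : reg s2 (var 1) = i /\ reg s2 (row 1) = i * n by rewrite !S2.2.
  apply: runs_if; rewrite /= R2 sem_selected /update /=.
    case sel : selected => // _; apply: runs_assign; split=> //=.
    split; last by rewrite split_sum sel; have [_ n2 [_ mw] _] := E2;
      rewrite /upd /= n2 v2 (mw oi) S2.2 // R1.
    by apply: frame_trans S02 _; exact: frame_assign.
  case sel : selected => // _; apply: runs_skip; split=> //.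
  by split=> //; rewrite split_sum sel addn0 S2.2 // R1.
split; first exact: frame_assign.
by rewrite /= big_pred0.
Qed.

Definition search_cost :=
  1 + (n * (cost n (Fvalid 1 0) + (sum_cost + 5).+1 + 3) + 3).

(** Invariant of the search loop over the generating vertices. *)
Definition best_below i (s : state) : Prop :=
  (reg s 3 = 0 /\ forall u : 'I_n, u < i -> ~~ valid adj u) \/
  (reg s 3 = 1 /\ exists v : 'I_n,
    [/\ valid adj v, reg s 4 = weight w (candidate adj w v),
        reg s 5 = v /\ reg s 6 = v * n &
        forall u : 'I_n, u < i -> valid adj u ->
          weight w (candidate adj w v) <= weight w (candidate adj w u)]).

Lemma best_below_same i s s' :
  (forall r, 2 < r < 7 -> reg s' r = reg s r) -> best_below i s -> best_below i s'.
Proof. by move=> R; rewrite /best_below !R. Qed.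

(** Extends a loop invariant quantified over the vertices below [i] by one round. *)
Lemma below_succ (P : 'I_n -> Prop) i (lt_in : i < n) :
  (forall u : 'I_n, u < i -> P u) -> P (Ordinal lt_in) ->
  forall u : 'I_n, u < i.+1 -> P u.
Proof.
move=> Pi Pn u; rewrite ltnS leq_eqVlt => /orP[/eqP ui|]; last exact: Pi.
by have <- : Ordinal lt_in = u by exact: val_inj.
Qed.

Lemma runs_search env s : holds_env 0 env s ->
  runs search_prog s search_cost (fun s' =>
    holds_env 0 env s' /\ best_below n s').
Proof.
move=> E; apply: (runs_seq (runs_assign (P := eq _) erefl)) => _ <- /=.
pose I i s' := holds_env 0 env s' /\ best_below i s'.
apply: (@runs_for _ _ _ _ I).
- move=> i s1 s2 [E1 B1] S2; split; first exact: holds_env_frame S2 E1.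
  by apply: best_below_same B1 => r r7; rewrite S2.2 // /var; lia.
- by move=> i s1 [[]].
- move=> i s1 lt_in [E1 B1] vi ri; pose oi := Ordinal lt_in.
  have F1 : holds_env 1 (update env 0 oi) s1 by apply: holds_env_var.
  apply: (runs_seq (@compile_correct _ adj w (Fvalid 1 0) 1 _ _ isT F1)) => s2 [S2 R2].
  have F2 := holds_env_frame (xs := [:: 0]) (leqnn 1) isT S2 F1.
  have weak s' : holds_env 1 (update env 0 oi) s' -> holds_env 0 env s'.
    by move=> [? ? ? _]; split.
  have B2 : best_below i s2.
    apply: best_below_same B1 => r r7; rewrite S2.2 // ?inE /var; lia.
  have [v2 r2] : reg s2 (var 0) = i /\ reg s2 (row 0) = i * n by rewrite !S2.2.
  apply: runs_if; rewrite /= R2 sem_valid /update /=; last first.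
    case val_i : (valid adj oi) => // _; apply: (runs_weaken (runs_skip (P := eq s2) erefl)) => [|_ <-].
      by lia.
    split=> //; split; first exact: weak.
    case: B2 => [[f nv]|[f [v [vv wv bv mv]]]]; [left|right]; split=> //.
      by apply: (@below_succ _ i lt_in) => //; rewrite -/oi val_i.
    exists v; split=> //; apply: (@below_succ _ i lt_in) => //.
    by rewrite -/oi val_i.
  case val_i : (valid adj oi) => // _.
  apply: (runs_seq (runs_sum F2)) => s3 [S3 R3].
  have F3 := holds_env_frame (xs := [:: 0; 7]) (leqnn 1) isT S3 F2.
  have B3 : best_below i s3.
    apply: best_below_same B2 => r r7; rewrite S3.2 // ?inE /var; lia.
  have [v3 r3] : reg s3 (var 0) = i /\ reg s3 (row 0) = i * n by rewrite !S3.2.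
  apply: runs_if => /=; rewrite R3.
    move=> /andP[/eqP f1]; rewrite -leqNgt => le4.
    apply: (runs_weaken (runs_skip (P := eq s3) erefl)) => // _ <-.
    split=> //; split; first exact: weak.
    case: B3 => [[]|[_ [v [vv wv bv mv]]]]; first by rewrite f1.
    right; split=> //; exists v; split=> //.
    by apply: (@below_succ _ i lt_in) => // _; rewrite -wv.
  move=> worse; rewrite [4](_ : _ = 1 + (1 + (1 + 1))) //.
  apply: (runs_seq (runs_assign (P := eq _) erefl)) => _ <- /=.
  apply: (runs_seq (runs_assign (P := eq _) erefl)) => _ <- /=.
  apply: (runs_seq (runs_assign (P := eq _) erefl)) => _ <- /=.
  apply: runs_assign; rewrite /= /upd /= v3 r3 R3; split=> //; split.
    by have [n1 n2 rep _] := F3; split.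
  right; split=> //; exists oi; split=> //; apply: (@below_succ _ i lt_in) => //.
  (* The record changes only if it was empty or the new weight is strictly smaller, so earlier
     comparisons carry over by transitivity. *)
  move=> u ui vu; case: B3 => [[_ /(_ u ui)]|[f [v [_ wv _ mv]]]]; first by rewrite vu.
  apply: leq_trans (mv u ui vu); rewrite -wv ltnW //.
  by move: worse; rewrite f /= negbK.
split; first by apply: (holds_env_frame (xs := [:: 3])) _ E => //; exact: frame_assign.
by left.
Qed.

Definition mark_cost := n * ((cost n Fsel + 1) + 3) + 3.
Definition output_cost := 1 + (1 + (mark_cost + ((n * (1 + 3) + 3) + 1))).

Lemma runs_output env s (v : 'I_n) :
  holds_env 0 env s -> reg s 5 = v -> reg s 6 = v * n ->
  runs output_prog s output_cost (fun s' =>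
    mem s' 0 = 2 /\ out_set n s' = candidate adj w v).
Proof.
move=> E r5 r6; apply: (runs_seq (runs_assign (P := eq _) erefl)) => _ <- /=.
apply: (runs_seq (runs_assign (P := eq _) erefl)) => _ <- /=.
set s0 := State _ _; pose vv (_ : nat) := v.
have E0 : holds_env 1 vv s0.
  have [n1 n2 rep _] := E; split=> //= x; rewrite ltnS leqn0 => /eqP->.
  by rewrite /upd /= r5 r6.
pose I i s' := holds_env 1 vv s' /\
  forall j : 'I_n, j < i -> mem s' (1 + (n * n + (n + j))) = selected adj w v j.
have ImarkP : runs mark_prog s0 mark_cost (I n).
  apply: runs_for.
  - move=> i s1 s2 [E1 M1] S2; split; first exact: holds_env_frame S2 E1.
    by move=> j; rewrite S2.1; exact: M1.
  - by move=> i s1 [[]].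
  - move=> i s1 lt_in [E1 M1] vi ri; pose oi := Ordinal lt_in.
    have F1 : holds_env 2 (update vv 1 oi) s1 by apply: holds_env_var.
    apply: (runs_seq (@compile_correct _ adj w Fsel 2 _ _ isT F1)) => s2 [S2 R2].
    have [n1 n2 [ma mw] e] := holds_env_frame (xs := [:: 0]) (leqnn 2) isT S2 F1.
    have [v2 r2] : reg s2 (var 1) = i /\ reg s2 (row 1) = i * n by rewrite !S2.2.
    apply: runs_store; rewrite /= n1 n2 v2 R2 sem_selected /update /=.
    split=> //; split.
      split=> //; last first.
        move=> x x1; have [] := e x (ltnW x1); rewrite /update.
        by move: x1; rewrite ltnS leqn0 => /eqP->.
      split=> [j1 j2|j]; rewrite /= /upd.
        have h1 := ltn_ord j1; have h2 := ltn_ord j2.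
        (* Row [j1] of the matrix ends within the first [n * n] entries, before the marks. *)
        have : j1.+1 * n <= n * n by rewrite leq_mul2r h1 orbT.
        by rewrite mulSn => h3; case: eqP => [|_]; [lia|exact: ma].
      by have h := ltn_ord j; case: eqP => [|_]; [lia|exact: mw].
    apply: (@below_succ _ i lt_in) => [j ji|]; rewrite /= /upd; last by rewrite eqxx.
    by case: eqP => [|_]; [lia|rewrite S2.1; exact: M1].
  by split.
apply: (runs_seq ImarkP) => s1 [E1 M1].
(* Copying overwrites the input, so this invariant keeps only the two registers, the marks and the
   copied cells. *)
pose J i s' := [/\ reg s' 1 = n, reg s' 2 = n * n,
  forall j : 'I_n, mem s' (1 + (n * n + (n + j))) = selected adj w v j &
  forall j : 'I_n, j < i -> mem s' (1 + j) = selected adj w v j].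
have JcopyP : runs copy_prog s1 (n * (1 + 3) + 3) (J n).
  apply: runs_for.
  - by move=> i s2 s3 [n1 n2 m1 m2] [m R]; split=> [||j|j]; rewrite ?R ?m; auto.
  - by move=> i s2 [].
  - move=> i s2 lt_in [n1 n2 m1 m2] vi ri; apply: runs_store.
    rewrite /= n1 n2 vi (m1 (Ordinal lt_in)); split=> //; split=> //=.
      by move=> j; rewrite /upd; case: eqP => [|_]; [lia|exact: m1].
    apply: (@below_succ _ i lt_in) => [j ji|]; rewrite /= /upd; last by rewrite eqxx.
    by case: eqP => [|_]; [lia|exact: m2].
  by have [n1 n2 _ _] := E1; split=> // j; apply: M1.
apply: (runs_seq JcopyP) => s2 [_ _ _ m2].
apply: runs_store => /=; split; first by rewrite /upd.
apply/setP => j; rewrite !inE /= /upd /= -add1n m2 //.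
by case: selected.
Qed.

Lemma runs_square s : reg s 1 = n -> reg s 2 = 0 -> represents (mem s) ->
  runs square_prog s (n * (1 + 3) + 3) (fun s' => forall env, holds_env 0 env s').
Proof.
move=> n1 n2 rep.
pose I i s' := [/\ reg s' 1 = n, reg s' 2 = i * n & mem s' = mem s].
apply: (@runs_weaken _ _ (n * (1 + 3) + 3) _ (I n)) => //; last first.
  by move=> s' [h1 h2 h3] env; split=> //; rewrite h3.
apply: runs_for => //.
- by move=> i s1 s2 [h1 h2 h3] [m R]; split; rewrite ?R // m.
- by move=> i s1 [].
move=> i s1 lt_in [h1 h2 h3] vi ri; apply: runs_assign; split=> //.
by split=> //; rewrite /= /upd /= h1 h2 mulSn addnC.
Qed.

Lemma represents_init : represents (mem (init_state adj w)).
Proof.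
split=> [i j|i] /=; rewrite !add1n /= subn1 /=; have hi := ltn_ord i.
  have hj := ltn_ord j; have : i.+1 * n <= n * n by rewrite leq_mul2r hi orbT.
  rewrite mulSn => h; rewrite (_ : _ < _); last by lia.
  rewrite divnMDl ?modnMDl; last by lia.
  by rewrite divn_small // modn_small // addn0 /adj_nat !valK.
by rewrite ltnNge leq_addr /= ltn_add2l hi addKn /w_nat valK.
Qed.

(** Robustness: answers 1 and 2 rest only on the graph being unobstructed, and an obstruction
    certifies answer 0. *)
Lemma wed_correct : simple_graph adj -> 0 < n ->
  runs wed_prog (init_state adj w)
    (1 + ((n * (1 + 3) + 3) + (cost n Fobstructed +
      (search_cost + output_cost.+1).+1)).+1)
    (robust_WED_output adj w).
Proof.
move=> adjG n_gt0; pose env (_ : nat) := Ordinal n_gt0.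
apply: (runs_seq (runs_assign (P := eq _) erefl)) => _ <- /=.
apply: runs_if => /=; rewrite /upd /= => n0; first by rewrite eqn0Ngt n_gt0 in n0.
have sq := @runs_square (State (fun y => if y == 1 then n else 0)
  (mem (init_state adj w))) erefl erefl represents_init.
apply: (runs_seq sq) => s1 /(_ env) E1 {sq}.
apply: (runs_seq (@compile_correct _ adj w Fobstructed 0 _ _ isT E1)) => s2 [S2 R2].
have E2 := holds_env_frame (xs := [:: 0]) (leqnn 0) isT S2 E1.
apply: runs_if; rewrite /= R2 sem_obstructed; case ob : obstructed => // _.
  apply: (@runs_weaken _ _ 1 _ (robust_WED_output adj w)) => //; apply: runs_store.
  by apply: Or31; split=> //; exact: (obstructed_not_free adjG ob).
apply: (runs_seq (runs_search E2)) => s3 [E3 B3].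
have best D : efficient_dominating adj D ->
    exists2 v, valid adj v & weight w (candidate adj w v) <= weight w D.
  by apply: candidate_optimal; rewrite ?ob.
apply: runs_if => /= [/eqP|] f3.
  apply: (@runs_weaken _ _ 1 _ (robust_WED_output adj w)) => //; apply: runs_store.
  apply: Or32; split=> // D /best[v vv _].
  case: B3 => [[_ /(_ v (ltn_ord v))]|[]]; first by rewrite vv.
  by rewrite f3.
case: B3 => [[f0]|[_ [v [vv wv [r5 r6] mv]]]]; first by rewrite f0 in f3.
apply: runs_weaken (runs_output E3 r5 r6) _ _ => // s4 [m0 out].
apply: Or33; split=> //; rewrite out; split; first exact: valid_efficient.
by move=> D /best[u vu]; apply: leq_trans; exact: mv.
Qed.
End Algorithm.

(** * The overall time bound *)

Lemma wed_correct0 (adj : rel 'I_0) w :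
  runs wed_prog (init_state adj w) 3 (robust_WED_output adj w).
Proof.
apply: (runs_seq (T1 := 1) (T2 := 2) (runs_assign (P := eq _) erefl)) => _ <- /=.
apply: runs_if => // _; apply: runs_store; apply: Or33; split=> //.
by split=> [[]|D _] //; rewrite /weight big_pred0 // => -[].
Qed.

(** [Fsel] counts twice, for the weight sums and for the marking; 50 absorbs the overhead. *)
Definition wed_factor :=
  fsize Fobstructed + fsize (Fvalid 1 0) + 2 * fsize Fsel + 50.

(** The exponent 5 arises as depth 5 for [Fobstructed], depth 4 inside one loop for [Fvalid], and
    depth 3 inside two loops for [Fsel]. *)
Lemma total_cost n : 0 < n ->
  1 + ((n * (1 + 3) + 3) + (cost n Fobstructed +
    (search_cost n + (output_cost n).+1).+1)).+1 <= wed_factor * n ^ 5.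
Proof.
move=> n_gt0.
have pow d : d <= 5 -> n ^ d <= n ^ 5 by move=> ?; rewrite leq_pexp2l.
have h0 := pow 0 isT; have h1 := pow 1 isT; have h2 := pow 2 isT.
have cob := @cost_le n Fobstructed 5 n_gt0 isT.
have cval : n * cost n (Fvalid 1 0) <= fsize (Fvalid 1 0) * n ^ 5.
  by rewrite expnS mulnCA leq_mul2l (@cost_le n (Fvalid 1 0) 4) ?orbT.
have csel : n * (n * cost n Fsel) <= fsize Fsel * n ^ 5.
  rewrite (expnS n 4) (expnS n 3) (mulnCA _ n) leq_mul2l (mulnCA _ n).
  by rewrite leq_mul2l (@cost_le n Fsel 3) ?orbT.
have csel' : n * cost n Fsel <= n * (n * cost n Fsel) by rewrite leq_pmull.
rewrite expn0 expn1 in h0 h1; rewrite expnS expn1 in h2.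
rewrite /search_cost /output_cost /mark_cost /sum_cost /wed_factor.
move: (cost _ _) (cost _ _) (cost _ _) (fsize _) (fsize _) (fsize _) (n ^ 5)
  cob cval csel csel' h0 h1 h2.
move=> a b c fa fb fc p.
nia.
Qed.

Theorem theorem5 :
  exists (prog : com) (c : nat),
    forall (n : nat) (adj : rel 'I_n) (w : 'I_n -> nat),
      simple_graph adj ->
      exists (s' : state) (k : nat),
        [/\ exec prog (init_state adj w) k s',
            k <= c * n ^ 5 + c
          & robust_WED_output adj w s'].
Proof.
exists wed_prog, wed_factor => n adj w adjG.
case: (posnP n) => [n0|n_gt0].
  (* Here [n ^ 5] is 0, and the additive constant pays for the 3 steps. *)
  by subst n; apply: (runs_weaken (wed_correct0 adj w)).
apply: (runs_weaken (wed_correct w adjG n_gt0)) => //.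
by apply: leq_trans (total_cost n_gt0) (leq_addr _ _).
Qed.
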